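(* Let $(M,d)$ be a complete pointed metric space with base point $0$. Let $\mu$ be a positive Radon measure on $\beta\widetilde{M}$ that is $\preccurlyeq$-minimal, concentrated on $\mathcal{R}:=p^{-1}(\mathcal{R}(M)\times\mathcal{R}(M))$, and satisfies $\Phi^*\mu\in\mathcal{F}(M)$. Then $\mu(\Gamma)=0$, where $\Gamma=p^{-1}\big((\mathcal{R}(M)\setminus M)\times(\mathcal{R}(M)\setminus M)\big)$.
   Context: $\mathrm{Lip}_0(M)$: Lipschitz $f:M\to\mathbb{R}$ with $f(0)=0$, normed by Lipschitz constant; $\mathcal{F}(M)\subset\mathrm{Lip}_0(M)^*$ is the closed linear span of the evaluation functionals $\delta(x)$, $x\in M$. $\widetilde{M}=\{(x,y)\in M\times M:x\ne y\}$, $\beta\widetilde{M}$ its Stone–Čech compactification, Radon measures on it identified with $C(\beta\widetilde{M})^*$. $\Phi:\mathrm{Lip}_0(M)\to C(\beta\widetilde{M})$ maps $f$ to the continuous extension of $(x,y)\mapsto(f(x)-f(y))/d(x,y)$; $\Phi^*$ is its adjoint. $M^u$ is the uniform (Samuel) compactification of $M$; $p_1,p_2:\beta\widetilde{M}\to M^u$ continuously extend the coordinate projections and $p=(p_1,p_2)$. $\mathcal{R}(M)=\{\xi\in M^u:\overline{d_0}(\xi)<\infty\}$ is the Lipschitz realcompactification, where $\overline{d_0}:M^u\to[0,\infty]$ is the continuous extension of $x\mapsto d(x,0)$. $G$ is the set of $g\in C(\beta\widetilde{M})$ with $d(x,y)g(x,y)\le d(x,u)g(x,u)+d(u,y)g(u,y)$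 for all distinct $x,u,y\in M$; for positive Radon measures, $\mu\preccurlyeq\nu$ iff $\int g\,d\mu\le\int g\,d\nu$ for all $g\in G$; $\mu$ is $\preccurlyeq$-minimal if every positive $\nu\preccurlyeq\mu$ satisfies $\mu\preccurlyeq\nu$. Throughout, $M$ has at least three distinct points. *)

(* Defs.v *)
From HB Require Import structures.
From mathcomp Require Import all_boot all_order all_algebra.
From mathcomp Require Import all_classical all_reals all_analysis.
Set Implicit Arguments. Unset Strict Implicit. Unset Printing Implicit Defensive.
Import Order.TTheory GRing.Theory Num.Theory.
Import numFieldNormedType.Exports.
Local Open Scope classical_set_scope.
Local Open Scope ring_scope.

Section Defs.
Context {R : realType} {M : Type} (d : M -> M -> R).

Definition is_metric :=
  (forall x y, 0 <= d x y) /\ (forall x y, d x y = 0 <-> x = y) /\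
  (forall x y, d x y = d y x) /\ (forall x y z, d x z <= d x y + d y z).

Definition metric_complete :=
  forall u : nat -> M,
    (forall eps : R, 0 < eps -> exists N, forall n m,
        (N <= n)%N -> (N <= m)%N -> d (u n) (u m) < eps) ->
    exists l, forall eps : R, 0 < eps -> exists N, forall n,
        (N <= n)%N -> d (u n) l < eps.

Definition bounded_tilde (g : M -> M -> R) :=
  exists C : R, forall x y, x <> y -> `|g x y| <= C.
Definition continuous_tilde (g : M -> M -> R) :=
  forall x y, x <> y -> forall eps : R, 0 < eps -> exists2 del : R, 0 < del &
    forall x' y', x' <> y' -> d x x' < del -> d y y' < del ->
      `|g x y - g x' y'| < eps.

(** (B, iota) is the Stone-Cech compactification of Mtilde: a compact
    Hausdorff space with a dense topological embedding of Mtilde in which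
    Mtilde is C*-embedded (every bounded continuous real function extends
    continuously). This characterizes beta Mtilde up to homeomorphism. *)
Definition is_stone_cech_tilde (B : topologicalType) (iota : M -> M -> B) :=
  compact [set: B] /\ hausdorff_space B /\
  (forall x y, x <> y -> forall V : set B, open V -> V (iota x y) ->
     exists2 del : R, 0 < del & forall x' y', x' <> y' ->
       d x x' < del -> d y y' < del -> V (iota x' y')) /\
  (forall x y, x <> y -> forall eps : R, 0 < eps -> exists V : set B,
     [/\ open V, V (iota x y) & forall x' y', x' <> y' -> V (iota x' y') ->
          d x x' < eps /\ d y y' < eps]) /\
  (forall V : set B, open V -> V !=set0 -> exists x y, x <> y /\ V (iota x y)) /\
  (forall g : M -> M -> R, bounded_tilde g -> continuous_tilde g ->
     exists G : B -> R, continuous G /\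
       forall x y, x <> y -> G (iota x y) = g x y).

Definition bounded_fun (f : M -> R) := exists C : R, forall x, `|f x| <= C.
Definition unif_continuous (f : M -> R) :=
  forall eps : R, 0 < eps -> exists2 del : R, 0 < del &
    forall x y, d x y < del -> `|f x - f y| < eps.

(** (K, j) is the uniform (Samuel) compactification M^u of M: a compact
    Hausdorff space with a dense topological embedding of M such that the
    functions of the form F o j, F in C(K), are exactly the bounded uniformly
    continuous functions on M. *)
Definition is_samuel (K : topologicalType) (j : M -> K) :=
  compact [set: K] /\ hausdorff_space K /\
  (forall x (V : set K), open V -> V (j x) ->
     exists2 del : R, 0 < del & forall y, d x y < del -> V (j y)) /\
  (forall x (eps : R), 0 < eps -> exists V : set K,
     [/\ open V, V (j x) & forall y, V (j y) -> d x y < eps]) /\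
  (forall V : set K, open V -> V !=set0 -> exists x, V (j x)) /\
  (forall f : M -> R, bounded_fun f -> unif_continuous f ->
     exists F : K -> R, continuous F /\ forall x, F (j x) = f x) /\
  (forall F : K -> R, continuous F -> unif_continuous (F \o j)).

Definition lip0 (x0 : M) (f : M -> R) :=
  f x0 = 0 /\ exists L : R, forall x y, `|f x - f y| <= L * d x y.

(** m : Lip_0(M) -> R belongs to F(M), the closed linear span in Lip_0(M)^*
    of the evaluations delta(x): m is linear on Lip_0(M) and is, in dual norm,
    a limit of finite linear combinations of evaluations. *)
Definition in_free (x0 : M) (m : (M -> R) -> R) :=
  (forall f g, lip0 x0 f -> lip0 x0 g -> m (fun x => f x + g x) = m f + m g) /\
  (forall (a : R) f, lip0 x0 f -> m (fun x => a * f x) = a * m f) /\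
  (forall eps : R, 0 < eps -> exists s : seq (R * M), forall f,
     f x0 = 0 -> (forall x y, `|f x - f y| <= d x y) ->
     `|m f - \sum_(p <- s) p.1 * f p.2| <= eps).

End Defs.

Section Meas.
Context {R : realType} {B : topologicalType}.

(** positive Radon measures on the compact space B, identified (Riesz) with
    positive linear functionals on C(B); only values on continuous functions
    are meaningful. *)
Definition pos_functional (mu : (B -> R) -> R) :=
  (forall f g : B -> R, continuous f -> continuous g ->
     mu (fun b => f b + g b) = mu f + mu g) /\
  (forall (a : R) (f : B -> R), continuous f -> mu (fun b => a * f b) = a * mu f) /\
  (forall f : B -> R, continuous f -> (forall b, 0 <= f b) -> 0 <= mu f).

(** mu(A) = 0 for the Radon measure mu, via the (outer-regular) Riesz
    construction: mu(U) = sup { mu f : f in C(B), 0 <= f <= 1_U } for U open,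
    mu(A) = inf { mu(U) : U open, A <= U }. *)
Definition radon_null (mu : (B -> R) -> R) (A : set B) :=
  forall eps : R, 0 < eps -> exists U : set B,
    [/\ open U, A `<=` U &
      forall f : B -> R, continuous f -> (forall b, 0 <= f b <= 1) ->
        (forall b, ~ U b -> f b = 0) -> mu f <= eps].

Context {M : Type} (d : M -> M -> R) (iota : M -> M -> B).

Definition in_G (g : B -> R) :=
  continuous g /\ forall x u y, x <> u -> u <> y -> x <> y ->
    d x y * g (iota x y) <= d x u * g (iota x u) + d u y * g (iota u y).

Definition preceq (mu nu : (B -> R) -> R) := forall g, in_G g -> mu g <= nu g.

Definition preceq_minimal (mu : (B -> R) -> R) :=
  forall nu, pos_functional nu -> preceq nu mu -> preceq mu nu.

(** Phi^* mu = m as functionals on Lip_0(M): <m, f> = int Phi f dmu, where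
    Phi f is the continuous extension to B of (x,y) |-> (f x - f y)/d(x,y). *)
Definition phistar_is (x0 : M) (mu : (B -> R) -> R) (m : (M -> R) -> R) :=
  forall f, lip0 d x0 f -> forall F : B -> R, continuous F ->
    (forall x y, x <> y -> F (iota x y) = (f x - f y) / d x y) -> m f = mu F.

End Meas.

Definition lip_realcomp {R : realType} {K : topologicalType}
  (dbar : K -> \bar R) : set K := [set xi | (dbar xi < +oo)%E].

(* Main.v *)
Require Import Defs.
From HB Require Import structures.
From mathcomp Require Import all_boot all_order all_algebra.
From mathcomp Require Import all_classical all_reals all_analysis.
From mathcomp Require Import ring lra.
Set Implicit Arguments. Unset Strict Implicit. Unset Printing Implicit Defensive.
Import Order.TTheory GRing.Theory Num.Theory.
Import numFieldNormedType.Exports.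
Local Open Scope classical_set_scope.
Local Open Scope ring_scope.

(* Think of mu as a flow from x to y of rate dmu / d(x, y), with divergence
   Phi^* mu.  As Phi^* mu lies in F(M), this divergence is almost carried by a
   finite set S, so flow passing through Gamma, which stays away from S because M
   is complete, must continue or loop.  Minimality forbids this: testing against
   k = min(d, r) / d, it provides a Lipschitz potential with oscillation at most
   r that drops by nearly min(d(x, y), r) along mu-almost every (x, y).  Cut off
   near S, this potential pairs with Phi^* mu to almost 0 but sees all the mass
   of k mu near Gamma, so that mass is arbitrarily small. *)

(** * The Hahn-Banach theorem for sublinear functionals *)

Section Sublinear.
Context {R : realType} {V : lmodType R}.

Definition sublinear_on (P : set V) (q : V -> R) :=
  (forall x y, P x -> P y -> q (x + y) <= q x + q y) /\
  (forall a x, 0 < a -> P x -> q (a *: x) <= a * q x).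

Definition linear_on (P : set V) (q : V -> R) :=
  (forall x y, P x -> P y -> q (x + y) = q x + q y) /\
  (forall a x, P x -> q (a *: x) = a * q x).

(** Auxiliary functional of the Hahn-Banach proof: it stays below [q] and is at most [- q a] at
    [- a], so a minimal [q] must be odd. *)
Definition tilt (q : V -> R) (a x : V) : R :=
  inf [set q (x + t *: a) - t * q a | t in [set t | 0 <= t]].

Context {P : set V}.
Hypothesis PD : forall x y, P x -> P y -> P (x + y).
Hypothesis PZ : forall a x, P x -> P (a *: x).

Lemma sublinear_onZ (q : V -> R) (a : R) (x : V) :
  sublinear_on P q -> 0 <= a -> P x -> q (a *: x) = a * q x.
Proof.
move=> [qD qZ]; rewrite le_eqVlt => /orP[/eqP<- Px|a0 Px].
  have P0 : P 0 by rewrite -(scale0r x); apply: PZ.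
  rewrite scale0r mul0r.
  (* Subadditivity gives [0 <= q 0], and scaling by one half gives [q 0 <= 0]. *)
  have := qD _ _ P0 P0; have := qZ (2^-1) 0 _ P0; rewrite addr0 scaler0.
  move=> /(_ _)/wrap[|h1 h2]; first by rewrite invr_gt0.
  lra.
apply/eqP; rewrite eq_le qZ//= -ler_pdivlMl//.
have := qZ a^-1 (a *: x); rewrite scalerA mulVf ?gt_eqF// scale1r; apply.
  by rewrite invr_gt0.
exact: PZ.
Qed.

Lemma sublinear_on0 (q : V -> R) (x : V) : sublinear_on P q -> P x -> q 0 = 0.
Proof. by move=> qs Px; rewrite -(scale0r x) sublinear_onZ// mul0r. Qed.

Lemma sublinear_onN (q : V -> R) (x : V) :
  sublinear_on P q -> P x -> - q (- x) <= q x.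
Proof.
move=> qs Px; have PN : P (- x) by rewrite -scaleN1r; apply: PZ.
by have := qs.1 _ _ Px PN; rewrite subrr (sublinear_on0 qs Px); lra.
Qed.

Lemma tilt_has_lbound (q : V -> R) (a x : V) : sublinear_on P q -> P a -> P x ->
  has_lbound [set q (x + t *: a) - t * q a | t in [set t | 0 <= t]].
Proof.
move=> qs Pa Px; exists (- q (- x)) => _ [t /= t0 <-].
have PN : P (- x) by rewrite -scaleN1r; apply: PZ.
have Pta := PZ t Pa.
have := qs.1 _ _ (PD Px Pta) PN.
by rewrite addrC addKr sublinear_onZ//; lra.
Qed.

Lemma tilt_le (q : V -> R) (a x : V) (t : R) :
  sublinear_on P q -> P a -> P x -> 0 <= t ->
  tilt q a x <= q (x + t *: a) - t * q a.
Proof.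
by move=> qs Pa Px t0; apply: ge_inf; [exact: tilt_has_lbound|exists t].
Qed.

Lemma le_tilt (q : V -> R) (a x : V) (c : R) :
  (forall t, 0 <= t -> c <= q (x + t *: a) - t * q a) -> c <= tilt q a x.
Proof.
move=> h; apply: lb_le_inf => [|_ [t /= t0 <-]]; last exact: h.
by exists (q (x + 0 *: a) - 0 * q a); exists 0; rewrite /=.
Qed.

Lemma sublinear_tilt (q : V -> R) (a : V) :
  sublinear_on P q -> P a -> sublinear_on P (tilt q a).
Proof.
move=> qs Pa; split=> [x y Px Py|c x c0 Px].
  rewrite -lerBlDr; apply: le_tilt => s s0; rewrite lerBlDr -lerBlDl.
  apply: le_tilt => t t0; rewrite lerBlDl.
  apply: le_trans (tilt_le qs Pa (PD Px Py) (addr_ge0 s0 t0)) _.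
  rewrite scalerDl addrACA.
  have := qs.1 _ _ (PD Px (PZ s Pa)) (PD Py (PZ t Pa)); lra.
rewrite -ler_pdivrMl//; apply: le_tilt => t t0; rewrite ler_pdivrMl//.
apply: le_trans (tilt_le qs Pa (PZ c Px) (mulr_ge0 (ltW c0) t0)) _.
rewrite -scalerA -scalerDr sublinear_onZ//; last 2 first.
- exact: ltW.
- by apply: PD => //; apply: PZ.
by rewrite mulrBr mulrA.
Qed.

Lemma tilt_le_id (q : V -> R) (a x : V) :
  sublinear_on P q -> P a -> P x -> tilt q a x <= q x.
Proof.
move=> qs Pa Px; apply: le_trans (tilt_le qs Pa Px (lexx 0)) _.
by rewrite scale0r addr0 mul0r subr0.
Qed.

Lemma tilt_opp (q : V -> R) (a : V) :
  sublinear_on P q -> P a -> tilt q a (- a) <= - q a.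
Proof.
move=> qs Pa; have PN : P (- a) by rewrite -scaleN1r; apply: PZ.
apply: le_trans (tilt_le qs Pa PN ler01) _.
by rewrite scale1r addNr mul1r (sublinear_on0 qs Pa) sub0r.
Qed.

(** By Zorn's lemma: the pointwise infimum of a nonempty chain is finite on [P], being at least
    [- q (- x)], and again sublinear. *)
Lemma minimal_sublinear (q : V -> R) : sublinear_on P q ->
  exists2 p, sublinear_on P p /\ (forall x, P x -> p x <= q x) &
    forall p', sublinear_on P p' -> (forall x, P x -> p' x <= p x) ->
      forall x, P x -> p x <= p' x.
Proof.
move=> qs.
pose T := {p : V -> R | sublinear_on P p /\ (forall x, P x -> p x <= q x)}.
pose rT (p p' : T) := `[< forall x, P x -> sval p' x <= sval p x >].
have t0 : T by exists q; split.
have [||A Atot|[p [ps pq]] pmin] := @ZL_preorder T t0 rT.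
- by move=> p; apply/asboolP.
- move=> p1 p2 p3 /asboolP h1 /asboolP h2; apply/asboolP => x Px.
  exact: le_trans (h2 x Px) (h1 x Px).
- have [[a Aa]|Aempty] := pselect (exists a, A a); last first.
    by exists t0 => s As; case: Aempty; exists s.
  pose i (x : V) := inf [set sval (p : T) x | p in A].
  have lb x : P x -> has_lbound [set sval (p : T) x | p in A].
    move=> Px; exists (- q (- x)) => _ [[p [ps pq]] _ <-] /=.
    have PN : P (- x) by rewrite -scaleN1r; apply: PZ.
    by apply: le_trans (sublinear_onN ps Px); rewrite lerN2; apply: pq.
  have ile x (p : T) : P x -> A p -> i x <= sval p x.
    by move=> Px Ap; apply: ge_inf; [exact: lb|exists p].
  have ilei x c : (forall p : T, A p -> c <= sval p x) -> c <= i x.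
    move=> h; apply: lb_le_inf; first by exists (sval a x), a.
    by move=> _ [p Ap <-]; apply: h.
  have is_ : sublinear_on P i /\ forall x, P x -> i x <= q x.
    split; last first.
      by move=> x Px; apply: le_trans (ile _ _ Px Aa) _; apply: (svalP a).2.
    split=> [x y Px Py|c x c0 Px].
      rewrite -lerBlDr; apply: (ilei) => p1 A1; rewrite lerBlDr -lerBlDl.
      apply: ilei => p2 A2; rewrite lerBlDl.
      (* Two members of a chain are comparable, so the smaller one serves [x] and [y] at once. *)
      have [h|h] := Atot _ _ A1 A2; move/asboolP: h => h.
        apply: le_trans (ile _ _ (PD Px Py) A2) _.
        by apply: le_trans ((svalP p2).1.1 _ _ Px Py) _; rewrite lerD2r h.
      apply: le_trans (ile _ _ (PD Px Py) A1) _.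
      by apply: le_trans ((svalP p1).1.1 _ _ Px Py) _; rewrite lerD2l h.
    rewrite -ler_pdivrMl//; apply: ilei => p Ap; rewrite ler_pdivrMl//.
    apply: le_trans (ile _ _ (PZ c Px) Ap) _.
    exact: (svalP p).1.2.
  exists (exist _ i is_) => s As; apply/asboolP => x Px /=; exact: ile.
exists p => // p' p's p'p x Px.
have p'q y : P y -> p' y <= q y.
  by move=> Py; apply: le_trans (p'p y Py) (pq y Py).
have /pmin : rT (exist _ p (conj ps pq)) (exist _ p' (conj p's p'q)).
  by apply/asboolP.
by move=> /asboolP; apply.
Qed.

(* A minimal sublinear functional equals all its tilts, hence is odd. *)
Theorem hahn_banach_sublinear (q : V -> R) (a : V) : sublinear_on P q -> P a ->
  exists nu, [/\ linear_on P nu, forall x, P x -> nu x <= q x & q a <= nu a].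
Proof.
move=> qs Pa.
(* Descending from the tilt at [a] rather than from [q] ensures [p (- a) <= - q a], that is,
   [q a <= p a] once [p] is odd. *)
have [p [ps pt] pmin] := minimal_sublinear (sublinear_tilt qs Pa).
have PN x : P x -> P (- x) by rewrite -scaleN1r; apply: PZ.
have pN x : P x -> p (- x) = - p x.
  move=> Px; apply/eqP; rewrite eq_le; apply/andP; split.
    apply: le_trans (tilt_opp ps Px).
    apply: (pmin _ (sublinear_tilt ps Px)) (PN _ Px).
    by move=> y Py; apply: tilt_le_id.
  by rewrite lerNl; have := sublinear_onN ps Px; lra.
exists p; split.
- split=> [x y Px Py|c x Px].
    apply/eqP; rewrite eq_le ps.1//=.
    have := ps.1 _ _ (PN _ Px) (PN _ Py).
    by rewrite -opprD !pN//; [lra|exact: PD].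
  have [c0|c0] := leP 0 c; first exact: sublinear_onZ.
  rewrite -[c]opprK scaleNr pN; last exact: PZ.
  by rewrite sublinear_onZ// ?mulNr// oppr_ge0 ltW.
- by move=> x Px; apply: le_trans (pt _ Px) (tilt_le_id qs Pa Px).
- by rewrite -lerN2 -pN//; apply: le_trans (pt _ (PN _ Pa)) (tilt_opp qs Pa).
Qed.

End Sublinear.

(** * Positive functionals and null sets *)

Section PositiveFunctional.
Context {R : realType} {B : topologicalType} {mu : (B -> R) -> R}.
Hypothesis mu_pos : pos_functional mu.

Lemma pos_functional_le (f g : B -> R) : continuous f -> continuous g ->
  (forall b, f b <= g b) -> mu f <= mu g.
Proof.
move=> fc gc fg; have [muD [_ mu0]] := mu_pos.
have hc : continuous (fun b => g b - f b).
  by move=> b; apply: cvgB; [exact: gc|exact: fc].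
have -> : g = (fun b => f b + (g b - f b)).
  by apply/funext => b; rewrite addrC subrK.
by rewrite muD// lerDl mu0// => b; rewrite subr_ge0.
Qed.

Lemma pos_functional_sum (u : nat -> B -> R) (N : nat) :
  (forall n, continuous (u n)) ->
  continuous (fun b => \sum_(i < N) u i b) /\
  mu (fun b => \sum_(i < N) u i b) = \sum_(i < N) mu (u i).
Proof.
move=> uc; have [muD [muZ _]] := mu_pos; elim: N => [|N [IHc IHm]].
  have -> : (fun b => \sum_(i < 0) u i b) = (fun=> 0).
    by apply/funext => b; rewrite big_ord0.
  split; first by move=> b; exact: cvg_cst.
  have c0 : continuous (fun _ : B => 0 : R) by move=> b; exact: cvg_cst.
  rewrite big_ord0 -[RHS](mul0r (mu (fun=> 0))) -muZ//.
  by congr mu; apply/funext => b; rewrite mul0r.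
have -> : (fun b => \sum_(i < N.+1) u i b) =
    (fun b => \sum_(i < N) u i b + u N b).
  by apply/funext => b; rewrite big_ord_recr.
split; first by move=> b; apply: cvgD; [exact: IHc|exact: uc].
by rewrite muD// IHm big_ord_recr.
Qed.

Lemma continuous_compact_bounded (f : B -> R) : compact [set: B] ->
  continuous f -> exists2 C : R, 0 <= C & forall b, `|f b| <= C.
Proof.
move=> Bc fc.
have /compact_near_coveringP Bn := Bc.
have [|N _ /(_ N (leqnn N)) hN] :=
    Bn nat \oo (fun n b => `|f b| <= n%:R) _; last first.
- exists N%:R; first exact: ler0n.
  by move=> b; apply: hN.
- move=> b _.
  have /cvgrPdist_lt/(_ 1 ltr01) nf := fc b.
  have [n nP] : exists n : nat, `|f b| + 1 <= n%:R.
    by exists (Num.bound (`|f b| + 1)); apply/ltW/archi_boundP; rewrite addr_ge0.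
  exists ([set b' | `|f b - f b'| < 1], [set m | (n <= m)%N]).
    by split => //=; exists n.
  move=> [b' m] /= [h nm].
  have : (n%:R : R) <= m%:R by rewrite ler_nat.
  have : `|f b'| <= `|f b| + `|f b - f b'|.
    by rewrite -[X in `|X| <= _](subrK (f b)) addrC -(distrC (f b'));
       apply: ler_normD.
  lra.
Qed.

Lemma open_preimage_gt (f : B -> R) (c : R) : continuous f ->
  open [set b | c < f b].
Proof. by move=> fc; apply: (open_comp _ (@open_gt R c)) => b _; exact: fc. Qed.

(* A compactness argument replaces partitions of unity: if f lives on the union
   of the sets {u n > 1}, finitely many u n dominate f up to a small constant. *)
Lemma radon_null_bigcup (A : nat -> set B) : compact [set: B] ->
  (forall n (eps : R), 0 < eps -> exists u : B -> R,
     [/\ continuous u, forall b, 0 <= u b, mu u <= eps &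
         forall b, A n b -> 1 < u b]) ->
  radon_null mu (\bigcup_n A n).
Proof.
move=> Bc hA eps eps0.
have [muD [muZ mu0]] := mu_pos.
have c1 : continuous (fun _ : B => 1 : R) by move=> b; exact: cvg_cst.
have e0 n : 0 < eps / (2 ^ n.+1)%:R by rewrite divr_gt0// ltr0n expn_gt0.
have /choice[u uP] n := hA n _ (e0 n).
have uc n : continuous (u n) by have [] := uP n.
have u0 n b : 0 <= u n b by have [] := uP n.
exists (\bigcup_n [set b | 1 < u n b]); split.
- by apply: bigcup_open => n _; exact: open_preimage_gt.
- by move=> b [n _ Ab]; exists n => //=; have [_ _ _] := uP n; apply.
move=> f fc f01 fU; apply/ler_addgt0Pr => e e_gt0.
have mu1 : 0 <= mu (fun=> 1) by apply: mu0.
pose del := e / (mu (fun=> 1) + 1).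
have del0 : 0 < del by rewrite divr_gt0//; lra.
have /compact_near_coveringP Bn := Bc.
have [b _|N _ /(_ N (leqnn N)) hN] :=
    Bn nat \oo (fun N b => f b <= del * 1 + \sum_(i < N) u i b) _.
  have s0 N b' : 0 <= \sum_(i < N) u i b' by apply: sumr_ge0.
  (* Near a point of the union a single [u n] exceeds [1], hence [f]; at any other point [f]
     vanishes, so it is below [del] nearby. *)
  have [[n _ /= ub]|nU] := pselect ((\bigcup_n [set b | 1 < u n b]) b).
    exists ([set b' | 1 < u n b'], [set m | (n < m)%N]).
      split => /=; last by exists n.+1.
      by apply: open_nbhs_nbhs; split => //; exact: open_preimage_gt.
    move=> [b' m] /= [h nm]; rewrite (bigD1 (Ordinal nm))//=.
    have : 0 <= \sum_(i < m | i != Ordinal nm) u i b' by apply: sumr_ge0.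
    by have /andP[_] := f01 b'; lra.
  exists ([set b' | f b' < del], [set: nat]).
    split => /=; last exact: filterT.
    apply: open_nbhs_nbhs; split; last by rewrite /= fU.
    by apply: (open_comp _ (@open_lt R del)) => b' _; exact: fc.
  by move=> [b' m] /= [h _]; have := s0 m b'; lra.
have [sc ms] := pos_functional_sum N uc.
have dc : continuous (fun _ : B => del * 1) by move=> b; exact: cvg_cst.
have tc : continuous (fun b => del * 1 + \sum_(i < N) u i b).
  by move=> b; apply: cvgD; [exact: dc|exact: sc].
apply: le_trans (pos_functional_le fc tc (fun b => hN b I)) _.
rewrite (muD _ _ dc sc) muZ// ms addrC lerD//; last first.
  by rewrite /del mulrAC ler_pdivrMr; nra.
have : \sum_(i < N) mu (u i) <= \sum_(i < N) eps / (2 ^ i.+1)%:R.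
  by apply: ler_sum => i _; have [] := uP i.
move=> /le_trans; apply.
suff -> : \sum_(i < N) eps / (2 ^ i.+1)%:R = eps - eps / (2 ^ N)%:R :> R.
  by rewrite gerBl divr_ge0// ltW.
elim: N {hN sc ms tc} => [|N IH]; first by rewrite big_ord0 expn0 divr1 subrr.
rewrite big_ord_recr /= IH expnS natrM.
have : (2 ^ N)%:R != 0 :> R by rewrite pnatr_eq0 expn_eq0.
by move=> ?; field.
Qed.

End PositiveFunctional.

(** * Minimality and the cone [G] *)

Section Minimal.
Context {R : realType} {M : Type} {d : M -> M -> R}.
Context {B : topologicalType} {iota : M -> M -> B}.
Hypothesis d_metric : is_metric d.

Lemma in_GD (g h : B -> R) : in_G d iota g -> in_G d iota h ->
  in_G d iota (fun b => g b + h b).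
Proof.
move=> [gc gG] [hc hG]; split=> [b|x u y xu uy xy].
  by apply: cvgD; [exact: gc|exact: hc].
by have := gG _ _ _ xu uy xy; have := hG _ _ _ xu uy xy; rewrite !mulrDr; lra.
Qed.

Lemma in_GZ (a : R) (g : B -> R) : 0 <= a -> in_G d iota g ->
  in_G d iota (fun b => a * g b).
Proof.
move=> a0 [gc gG]; split=> [b|x u y xu uy xy].
  by apply: cvgM; [exact: cvg_cst|exact: gc].
have := gG _ _ _ xu uy xy.
by rewrite !(mulrCA _ a) -mulrDr => h; apply: ler_wpM2l.
Qed.

Lemma in_G_cst (c : R) : 0 <= c -> in_G d iota (fun=> c).
Proof.
move=> c0; split=> [b|x u y xu uy xy]; first exact: cvg_cst.
by rewrite -mulrDl ler_wpM2r//; apply: d_metric.2.2.2.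
Qed.

Context {mu : (B -> R) -> R}.
Hypotheses (B_compact : compact [set: B]) (mu_pos : pos_functional mu).

(** The sublinear bound for Hahn-Banach: it is at most [mu h] for [h] in [G] and at most [0] for
    continuous [h <= 0], so linear functionals below it are positive and precede [mu]. *)
Definition upper_envelope (h : B -> R) : R :=
  inf [set mu g | g in [set g | in_G d iota g /\ forall b, h b <= g b]].

Lemma upper_envelope_le (h g : B -> R) : continuous h -> in_G d iota g ->
  (forall b, h b <= g b) -> upper_envelope h <= mu g.
Proof.
move=> hc gG hg; apply: ge_inf; last by exists g.
exists (mu h) => _ [g' [[g'c _] hg'] <-].
exact: (pos_functional_le mu_pos hc g'c hg').
Qed.

Lemma le_upper_envelope (h : B -> R) (c : R) : continuous h ->
  (forall g, in_G d iota g -> (forall b, h b <= g b) -> c <= mu g) ->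
  c <= upper_envelope h.
Proof.
move=> hc hle; apply: lb_le_inf => [|_ [g [gG hg] <-]]; last exact: hle.
have [C C0 hC] := continuous_compact_bounded B_compact hc.
exists (mu (fun=> C)); exists (fun=> C) => //; split; first exact: in_G_cst.
by move=> b; apply: le_trans (hC b); apply: ler_norm.
Qed.

Lemma sublinear_upper_envelope :
  sublinear_on [set h : B -> R^o | continuous h] upper_envelope.
Proof.
have [muD [muZ _]] := mu_pos.
split=> [x y xc yc|a x a0 xc].
  rewrite -lerBlDr; apply: le_upper_envelope => // g gG xg.
  rewrite lerBlDr -lerBlDl; apply: le_upper_envelope => // h hG yh.
  rewrite lerBlDl -muD; [|exact: gG.1|exact: hG.1].
  apply: upper_envelope_le; [|exact: in_GD|by move=> b; apply: lerD].
  by move=> b; apply: cvgD; [exact: xc|exact: yc].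
rewrite -ler_pdivrMl//; apply: le_upper_envelope => // g gG xg.
rewrite ler_pdivrMl// -muZ; last exact: gG.1.
apply: upper_envelope_le; [|exact/in_GZ/gG/ltW|].
  by move=> b; apply: cvgM; [exact: cvg_cst|exact: xc].
by move=> b; rewrite ler_pM2l.
Qed.

(* Any linear functional below the upper envelope is a positive measure below
   mu in the order, and one of them attains the envelope at -k. *)
Lemma minimal_G_approx (k : B -> R) (eps : R) : preceq_minimal d iota mu ->
  in_G d iota k -> 0 < eps ->
  exists2 g, in_G d iota g /\ (forall b, - k b <= g b) &
    mu (fun b => g b + k b) <= eps.
Proof.
move=> mu_min kG eps0; have [muD _] := mu_pos.
have c0 : continuous (fun _ : B => 0 : R) by move=> b; exact: cvg_cst.
have kNc : continuous (fun b => - k b) by move=> b; apply: cvgN; exact: kG.1.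
have PD (x y : B -> R^o) : continuous x -> continuous y -> continuous (x + y).
  by move=> xc yc b; apply: cvgD; [exact: xc|exact: yc].
have PZ (a : R) (x : B -> R^o) : continuous x -> continuous (a *: x).
  by move=> xc b; apply: cvgM; [exact: cvg_cst|exact: xc].
have [nu [[nuD nuZ] nuQ Qnu]] := @hahn_banach_sublinear R (B -> R^o)
  [set h : B -> R^o | continuous h] PD PZ _ (fun b => - k b)
  sublinear_upper_envelope kNc.
have nuN f : continuous f -> nu (fun b => - f b) = - nu f.
  move=> fc; rewrite -mulN1r -nuZ//; congr nu; apply/funext => b.
  by rewrite -[LHS]mulN1r.
have nu_pos : pos_functional nu.
  split; [exact: nuD|split; [exact: nuZ|]] => f fc f0.
  rewrite -oppr_le0 -nuN//.
  have fNc : continuous (fun b => - f b) by move=> b; apply: cvgN; exact: fc.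
  apply: le_trans (nuQ _ fNc) _.
  have [_ [muZ _]] := mu_pos.
  rewrite -[leRHS](mul0r (mu (fun=> 0))) -muZ//; apply: upper_envelope_le => //.
    by apply: in_GZ => //; apply: in_G_cst.
  by move=> b; rewrite mul0r oppr_le0.
have /mu_min /(_ _ kG) mknk : preceq d iota nu mu.
  move=> g gG; apply: le_trans (nuQ _ gG.1) _.
  exact: upper_envelope_le gG.1 gG _.
have {}Qnu : upper_envelope (fun b => - k b) <= - mu k.
  apply: le_trans Qnu _; rewrite nuN; last exact: kG.1.
  by rewrite lerN2 mknk.
(* Otherwise each majorant [g] of [- k] in [G] has [mu g > eps - mu k], which keeps the envelope at
   [- k] above [- mu k]. *)
apply: contrapT => noG.
suff : - mu k + eps <= upper_envelope (fun b => - k b) by lra.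
apply: le_upper_envelope => // g gG kg; rewrite leNgt; apply/negP => gk.
apply: noG; exists g => //; rewrite muD; [lra|exact: gG.1|exact: kG.1].
Qed.

End Minimal.

(** * Points of the Samuel compactification far from [M] *)

Definition far_from {R : realType} {M : Type} (d : M -> M -> R)
    {K : topologicalType} (j : M -> K) (rho : R) : set K :=
  [set xi | forall s, exists V : set K,
     [/\ open V, V xi & forall x, V (j x) -> rho <= d s x]].

(** The neighbourhood in [far_from] depends on the centre, so only finitely many centres can be
    treated together; this suffices for the finite set of [small_majorant]. *)
Lemma far_from_finite (R : realType) (M : Type) (d : M -> M -> R)
    (K : topologicalType) (j : M -> K) (rho : R) (xi : K) (a : nat -> M)
    (N : nat) : far_from d j rho xi -> exists V : set K,
  [/\ open V, V xi &
    forall x, V (j x) -> forall i, (i < N)%N -> rho <= d (a i) x].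
Proof.
move=> far; elim: N => [|N [V [oV Vxi VP]]].
  by exists setT; split => //; exact: openT.
have [W [oW Wxi WP]] := far (a N); exists (V `&` W); split => //.
  exact: openI.
move=> x [Vx Wx] i; rewrite ltnS leq_eqVlt => /orP[/eqP->|]; first exact: WP.
exact: VP.
Qed.

Section Escape.
Context {R : realType} {M : Type} {d : M -> M -> R}.
Context {K : topologicalType} {j : M -> K}.
Hypotheses (d_metric : is_metric d) (d_complete : metric_complete d).
Hypothesis K_samuel : is_samuel d j.

(** Truncating at [1] gives a bounded uniformly continuous function and leaves small distances
    unchanged. *)
Lemma distance_extension (s : M) : exists F : K -> R,
  continuous F /\ forall x, F (j x) = Num.min (d s x) 1.
Proof.
have [d0 [_ [dC dT]]] := d_metric.
have [_ [_ [_ [_ [_ [ext _]]]]]] := K_samuel; apply: ext.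
  exists 1 => x; rewrite ger0_norm; first by rewrite ge_min lexx orbT.
  by rewrite le_min d0 ler01.
move=> eps eps0; exists eps => // x y xy; apply: le_lt_trans xy.
have := dT s x y; have := dT s y x; rewrite (dC y x).
by rewrite ler_norml; case: (leP (d s x) 1); case: (leP (d s y) 1); lra.
Qed.

(* If xi had distance 0 to M, points of M approaching it would form a Cauchy
   sequence, whose limit would be xi. *)
Lemma samuel_far (xi : K) : ~ (exists x, xi = j x) ->
  exists2 rho : R, 0 < rho & far_from d j rho xi.
Proof.
have [d0 [d_eq0 [dC dT]]] := d_metric.
have [_ [K_T2 [j_cont [_ [j_dense _]]]]] := K_samuel.
move=> xiM; apply: contrapT => nofar.
(* Failure of [far_from] at [1/(n+1)] gives a centre with points of [M] closer than that in every
   neighbourhood of [xi]. *)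
have near_xi n : exists s, forall V : set K, open V -> V xi ->
    exists2 x, V (j x) & d s x < n.+1%:R^-1.
  apply: contrapT => h; apply: nofar; exists n.+1%:R^-1.
    by rewrite invr_gt0 ltr0n.
  move=> s; apply: contrapT => nV; apply: h; exists s => V oV Vxi.
  apply: contrapT => nx; apply: nV; exists V; split => // x Vx.
  by rewrite leNgt; apply/negP => sx; apply: nx; exists x.
have {near_xi}[s sP] := choice near_xi.
have /choice[F FP] := distance_extension.
have Fs n : F (s n) xi <= n.+1%:R^-1.
  rewrite leNgt; apply/negP => h.
  have [x /=] := sP n _ (open_preimage_gt n.+1%:R^-1 (FP (s n)).1) h.
  by rewrite (FP _).2 lt_min => /andP[h1 _] h2; have := lt_trans h1 h2; rewrite ltxx.
have oF (a : M) (c : R) : open [set z | F a z < c].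
  by apply: (open_comp _ (@open_lt R c)) => z _; exact: (FP a).1.
(* Density yields a point of [M] close to both [a] and [b]; thresholds at most [1] keep the
   truncation inactive. *)
have common (a b : M) (c e : R) : F a xi < c -> F b xi < e -> c <= 1 -> e <= 1 ->
    d a b < c + e.
  move=> ac be c1 e1.
  have [||x [/=]] := j_dense ([set z | F a z < c] `&` [set z | F b z < e]).
  - by apply: openI.
  - by exists xi.
  rewrite !(FP _).2 !gt_min => /orP[ax|]; last by lra.
  move=> /orP[bx|]; last by lra.
  by have := dT a x b; rewrite (dC x b); lra.
have small (e : R) : 0 < e -> exists N, forall n, (N <= n)%N ->
    F (s n) xi < Num.min e 1.
  move=> e0; have me0 : 0 < Num.min e 1 by rewrite lt_min e0 ltr01.
  exists (Num.bound (Num.min e 1)^-1) => n Nn; apply: le_lt_trans (Fs n) _.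
  rewrite -[ltRHS]invrK ltf_pV2 ?posrE ?ltr0n ?invr_gt0//.
  have /lt_le_trans : (Num.min e 1)^-1 < (Num.bound (Num.min e 1)^-1)%:R.
    by apply: archi_boundP; rewrite invr_ge0 ltW.
  by apply; rewrite ler_nat (leq_trans Nn).
have [e e0|l sl] := d_complete (u := s).
  have [N hN] : exists N, forall n, (N <= n)%N -> F (s n) xi < Num.min (e / 2) 1.
    by apply: small; lra.
  exists N => n m /hN hn /hN hm.
  have : Num.min (e / 2) 1 <= 1 by rewrite ge_min lexx orbT.
  have : Num.min (e / 2) 1 <= e / 2 by rewrite ge_min lexx.
  by move=> h h1; have := common _ _ _ _ hn hm h1 h1; lra.
apply: xiM; exists l; apply: contrapT => /eqP xil.
move: K_T2; rewrite open_hausdorff => /(_ _ _ xil)[[V W] /= [Vxi Wl] [oV oW VW]].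
have [del del0 ball_W] := j_cont l W oW (set_mem Wl).
have [N hN] : exists N, forall n, (N <= n)%N -> F (s n) xi < Num.min (del / 2) 1.
  by apply: small; lra.
have [N' hN'] : exists N', forall n, (N' <= n)%N -> d (s n) l < del / 2.
  by apply: sl; lra.
have {}hN := hN _ (leq_maxl N N'); have {}hN' := hN' _ (leq_maxr N N').
set n := maxn N N' in hN hN'.
(* A point of [V] close to [s n] is close to [l], hence lies in [W], against disjointness. *)
have [||x [/= Vx]] := j_dense (V `&` [set z | F (s n) z < Num.min (del / 2) 1]).
- exact: openI.
- by exists xi; split => //; exact: set_mem.
rewrite (FP _).2 lt_min => sx.
have Wx : W (j x).
  apply: ball_W; have := dT l (s n) x; rewrite (dC l (s n)).
  by move: sx; case: (leP (d (s n) x) 1) => ? /andP[]; lra.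
by have : (V `&` W) (j x) by []; rewrite (eqP VW).
Qed.

End Escape.

(** * Extensions to the Stone-Cech compactification and the majorant *)

Section Majorant.
Context {R : realType} {M : Type} {d : M -> M -> R} {x0 : M}.
Context {B : topologicalType} {iota : M -> M -> B}.
Hypotheses (d_metric : is_metric d) (B_sc : is_stone_cech_tilde d iota).

Lemma stone_cech_ge (u : B -> R) (V : set B) (c : R) : continuous u -> open V ->
  (forall x y, x <> y -> V (iota x y) -> c <= u (iota x y)) ->
  forall b, V b -> c <= u b.
Proof.
have [_ [_ [_ [_ [dense _]]]]] := B_sc.
move=> uc oV cu b Vb; rewrite leNgt; apply/negP => ub.
have [||x [y [xy [/= Vxy]]]] := dense (V `&` [set z | u z < c]).
- apply: openI => //; apply: (open_comp _ (@open_lt R c)) => z _; exact: uc.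
- by exists b.
by rewrite ltNge cu.
Qed.

(** Serves both [N x y = h x - h y] and [N = min(d, r)]: the quotient is bounded by [L] and
    continuous off the diagonal. *)
Lemma quotient_extension (N : M -> M -> R) (L : R) :
  (forall x y, `|N x y| <= L * d x y) ->
  (forall x y x' y', `|N x y - N x' y'| <= L * (d x x' + d y y')) ->
  exists G : B -> R, continuous G /\
    forall x y, x <> y -> G (iota x y) = N x y / d x y.
Proof.
have [d0 [d_eq0 [dC dT]]] := d_metric.
have [_ [_ [_ [_ [_ ext]]]]] := B_sc.
have d_gt0 x y : x <> y -> 0 < d x y.
  by move=> xy; rewrite lt_neqAle d0 andbT; apply/eqP => /esym/d_eq0.
move=> NL Nlip; apply: (ext (fun x y => N x y / d x y)).
  exists L => x y /d_gt0 xy.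
  by rewrite normrM normfV (gtr0_norm xy) ler_pdivrMr.
move=> x y /d_gt0 xy eps eps0.
have L0 : 0 <= L by have := le_trans (normr_ge0 _) (NL x y); rewrite pmulr_lge0.
(* Each of the two terms split off below costs at most [L * (d x x' + d y y') * d x' y'], whence
   [4 * L]; the [1] covers [L = 0]. *)
exists (eps * d x y / (4 * L + 1)) => [|x' y' /d_gt0 xy'].
  by rewrite !mulr_gt0// invr_gt0; lra.
rewrite !ltr_pdivlMr; [|lra..] => dx dy.
rewrite (_ : _ - _ = ((N x y - N x' y') * d x' y' + N x' y' * (d x' y' - d x y))
    / (d x y * d x' y')); last by field; rewrite !gt_eqF.
rewrite normrM normfV (gtr0_norm (mulr_gt0 xy xy')) ltr_pdivrMr ?mulr_gt0//.
apply: le_lt_trans (ler_normD _ _) _; rewrite !normrM (gtr0_norm xy').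
have dd : `|d x' y' - d x y| <= d x x' + d y y'.
  have := dT x x' y; have := dT x' y' y; have := dT x' x y'; have := dT x y y'.
  by rewrite (dC x' x) (dC y' y) ler_norml; lra.
have h1 : `|N x y - N x' y'| * d x' y' <= L * (d x x' + d y y') * d x' y'.
  by rewrite ler_pM2r.
have h2 : `|N x' y'| * `|d x' y' - d x y| <= L * d x' y' * (d x x' + d y y').
  exact: ler_pM.
have h3 : 2 * L * (d x x' + d y y') < eps * d x y.
  have := d0 x x'; have := d0 y y'; have : 0 < eps * d x y by rewrite mulr_gt0.
  nra.
have : 2 * L * (d x x' + d y y') * d x' y' < eps * d x y * d x' y'.
  by rewrite ltr_pM2r.
lra.
Qed.

Lemma lip_extension (h : M -> R) (L : R) :
  (forall x y, `|h x - h y| <= L * d x y) ->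
  exists G : B -> R, continuous G /\
    forall x y, x <> y -> G (iota x y) = (h x - h y) / d x y.
Proof.
move=> hL; apply: (quotient_extension (L := L)) => // x y x' y'.
rewrite (_ : _ - _ = (h x - h x') - (h y - h y')); last by ring.
by apply: le_trans (ler_normB _ _) _; rewrite mulrDr lerD.
Qed.

(** [min(d, r)] inherits the triangle inequality, which is the condition for [k] to lie in [G]. *)
Lemma truncated_metric (r : R) : 0 < r -> exists2 k : B -> R, in_G d iota k &
  forall x y, x <> y -> k (iota x y) = Num.min (d x y) r / d x y.
Proof.
have [d0 [d_eq0 [dC dT]]] := d_metric => r0.
have [||k [kc kE]] := @quotient_extension (fun x y => Num.min (d x y) r) 1.
- move=> x y; rewrite mul1r ger0_norm; first by rewrite ge_min lexx.
  by rewrite le_min d0 ltW.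
- move=> x y x' y'; rewrite mul1r.
  have := dT x x' y; have := dT x' y' y; have := dT x' x y'; have := dT x y y'.
  rewrite (dC x' x) (dC y' y) ler_norml.
  by case: (leP (d x y) r); case: (leP (d x' y') r); lra.
exists k => //; split=> // x u y xu uy xy.
have dK a b : a <> b -> d a b * k (iota a b) = Num.min (d a b) r.
  move=> ab; rewrite kE// mulrC divfK//; apply/eqP => /d_eq0; exact: ab.
rewrite !dK//; have := dT x u y; have := d0 x u; have := d0 u y.
by case: (leP (d x y) r); case: (leP (d x u) r); case: (leP (d u y) r); lra.
Qed.

(** The arbitrary value at [iota x x] is cancelled by [d x x = 0], so among coinciding points only
    [x = y] takes work. *)
Lemma in_G_triangle (g : B -> R) (x u y : M) :
  (exists a b c : M, [/\ a <> b, b <> c & a <> c]) -> in_G d iota g ->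
  d x y * g (iota x y) <= d x u * g (iota x u) + d u y * g (iota u y).
Proof.
have [d0 [d_eq0 [dC dT]]] := d_metric => three [_ gG].
have dxx a : d a a = 0 by apply/d_eq0.
have [->|/eqP xu] := eqVneq (x : {classic M}) u; first by rewrite dxx mul0r add0r.
have [->|/eqP uy] := eqVneq (u : {classic M}) y; first by rewrite dxx mul0r addr0.
have [xy|/eqP xy] := eqVneq (x : {classic M}) y; last exact: gG.
rewrite -xy dxx mul0r.
(* With [D = d * g], the goal is [0 <= D x u + D u x]: add the inequalities for [x, u, z] and
   [u, x, z], where [z] is a third point. *)
have [z xz uz] : exists2 z : M, x <> z & u <> z.
  have [a [b [c [ab bc ac]]]] := three; apply: contrapT => h.
  have h' z : x = z \/ u = z.
    by apply: contrapT => /not_orP[? ?]; apply: h; exists z.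
  by have [] := h' a; have [] := h' b; have [] := h' c; congruence.
have ux : u <> x by move=> ux; apply: xu.
by have := gG _ _ _ xu uz xz; have := gG _ _ _ ux xz uz; lra.
Qed.

Context {mu : (B -> R) -> R}.
Hypotheses (mu_pos : pos_functional mu) (mu_min : preceq_minimal d iota mu).
Hypothesis three : exists a b c : M, [/\ a <> b, b <> c & a <> c].
Hypothesis mu_free : exists m, in_free d x0 m /\ phistar_is d iota x0 mu m.

(** [h / C] is in the unit ball and vanishes where the approximating combination of evaluations is
    supported, so [Phi^* mu] is at most [eps / C] on it. *)
Lemma phistar_small (C eps : R) : 0 < C -> 0 < eps ->
  exists (N : nat) (a : nat -> M), forall h,
    (forall x y, `|h x - h y| <= C * d x y) ->
    h x0 = 0 -> (forall i, (i < N)%N -> h (a i) = 0) ->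
    forall H : B -> R, continuous H ->
      (forall x y, x <> y -> H (iota x y) = (h x - h y) / d x y) -> mu H <= eps.
Proof.
move=> C0 eps0; have [m [[_ [mZ mS]] mE]] := mu_free.
have [s sP] := mS (eps / C) (divr_gt0 eps0 C0).
exists (size s), (fun i => (nth (0, x0) s i).2) => h hC h0 ha H Hc HE.
have hlip : lip0 d x0 h by split => //; exists C.
rewrite -(mE _ hlip _ Hc HE) -(@ler_pM2l _ C^-1) ?invr_gt0//.
rewrite -mZ// (mulrC _ eps); apply: le_trans (ler_norm _) _.
have := sP (fun x => C^-1 * h x).
rewrite (_ : \sum_(p <- s) _ = 0) ?subr0; last first.
  rewrite (big_nth (0, x0)) big_nat_cond big1// => i; rewrite andbT => /andP[_ si].
  by rewrite ha// !mulr0.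
apply; first by rewrite h0 mulr0.
move=> x y; rewrite -mulrBr normrM gtr0_norm ?invr_gt0//.
by rewrite ler_pdivrMl.
Qed.

(* Minimality gives g in G with g >= -k and mu (g + k) small, where
   k = min(d, r) / d.  With D = d g, the function F y = inf_s D s y takes values
   in [-r, 0] and decreases by nearly min(d x y, r) from x to y for mu-most
   (x, y), whereas w = min(d(S, -), r) increases by at most min(d x y, r).  Hence
   h = max(F + w, 0), which vanishes on the finite set S carrying almost all of
   Phi^* mu, is nearly nonincreasing along mu, and it decreases by nearly
   min(d x y, r) when x and y are r-far from S. *)
Lemma small_majorant (r eps : R) : 0 < r -> 0 < eps ->
  exists (u : B -> R) (N : nat) (a : nat -> M),
    [/\ continuous u, forall b, 0 <= u b, mu u <= eps &
      forall x y, x <> y ->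
        (forall i, (i < N)%N -> r <= d (a i) x /\ r <= d (a i) y) ->
        Num.min (d x y) r / d x y <= u (iota x y)].
Proof.
have [d0 [d_eq0 [dC dT]]] := d_metric => r0 eps0.
have dxx a : d a a = 0 by apply/d_eq0.
have d_gt0 x y : x <> y -> 0 < d x y.
  by move=> xy; rewrite lt_neqAle d0 andbT; apply/eqP => /esym/d_eq0.
have B_compact := B_sc.1.
have [k kG kE] := truncated_metric r0.
have e2 : 0 < eps / 2 by lra.
have [g [gG kg] gk] := minimal_G_approx d_metric B_compact mu_pos mu_min kG e2.
have [C C0 gC] := continuous_compact_bounded B_compact gG.1.
pose D x y := d x y * g (iota x y).
have Dtri x u y : D x y <= D x u + D u y by exact: in_G_triangle.
have DC x y : D x y <= C * d x y.
  by rewrite /D mulrC ler_wpM2r//; apply: le_trans (gC (iota x y)); apply: ler_norm.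
have Dr x y : - Num.min (d x y) r <= D x y.
  have [->|/eqP xy] := eqVneq (x : {classic M}) y.
    by rewrite /D dxx mul0r oppr_le0 le_min lexx ltW.
  have dxy := d_gt0 _ _ xy.
  have := kg (iota x y); rewrite kE// -(@ler_pM2l _ (d x y))// mulrN mulrCA.
  by rewrite mulfV ?gt_eqF// mulr1.
pose F y := inf [set D s y | s in [set: M]].
have F_lb y : has_lbound [set D s y | s in [set: M]].
  exists (- r) => _ [s _ <-]; apply: le_trans (Dr s y).
  by rewrite lerN2 ge_min lexx orbT.
have FD s y : F y <= D s y by apply: ge_inf => //; exists s.
have le_F y c : (forall s, c <= D s y) -> c <= F y.
  move=> h; apply: lb_le_inf; first by exists (D y y), y.
  by move=> _ [s _ <-]; exact: h.
have F_le0 y : F y <= 0 by have := FD y y; rewrite /D dxx mul0r.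
have F_ge y : - r <= F y.
  apply: (le_F) => s; apply: le_trans (Dr s y).
  by rewrite lerN2 ge_min lexx orbT.
have F_step x y : F y <= F x + D x y.
  rewrite -lerBlDr; apply: (le_F) => s; rewrite lerBlDr.
  exact: le_trans (FD s y) (Dtri s x y).
(* [C + 1] will be a Lipschitz constant of [h]: [C] from [F] and [1] from [w]. *)
have [N [a0 small]] := @phistar_small (C + 1) _ (ltr_wpDl C0 ltr01) e2.
(* Padding makes the centre of index [N] the base point, so that [h x0 = 0]. *)
pose a i := if (i < N)%N then a0 i else x0.
pose w x := \big[Num.min/r]_(i < N.+1) d (a i) x.
have w_le x (i : nat) : (i < N.+1)%N -> w x <= d (a i) x.
  by move=> iN; apply: (bigmin_le _ (Ordinal iN)).
have w_ge0 x : 0 <= w x by apply/bigmin_geP; split => //; exact: ltW.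
have w_le_r x : w x <= r by exact: bigmin_le_id.
have w_lip x y : w x <= w y + d x y.
  rewrite -lerBlDr; apply/bigmin_geP; split => [|i _].
    by have := w_le_r x; have := d0 x y; lra.
  have := w_le x i (ltn_ord i); have := dT (a i) y x; rewrite (dC y x); lra.
have w_step x y : w y <= w x + Num.min (d x y) r.
  have := w_lip y x; rewrite (dC y x); have := w_le_r y; have := w_ge0 x.
  by case: (leP (d x y) r); lra.
pose h x := Num.max (F x + w x) 0.
(* Of the two arguments of the maximum, [F y + w y] is bounded by the steps of [F] and [w], and [0]
   because [D >= - min(d, r)]. *)
have h_step x y : h y <= h x + (D x y + Num.min (d x y) r).
  have hx : 0 <= h x /\ F x + w x <= h x by rewrite /h !le_max !lexx orbT.
  rewrite {1}/h ge_max; have := F_step x y; have := w_step x y; have := Dr x y.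
  lra.
have h_lip x y : `|h x - h y| <= (C + 1) * d x y.
  suff hl p q : h p - h q <= (C + 1) * d p q.
    by rewrite ler_norml hl andbT -lerN2 opprK opprB (dC x y).
  have := F_step q p; have := DC q p; have := w_lip p q; rewrite (dC q p).
  rewrite mulrDl mul1r /h; have : 0 <= C * d p q by exact: mulr_ge0.
  have := d0 p q; case: (leP (F p + w p) 0); case: (leP (F q + w q) 0); lra.
have h_a i : (i < N.+1)%N -> h (a i) = 0.
  move=> iN; apply/max_r; have := w_le (a i) i iN; have := F_le0 (a i).
  by rewrite dxx; lra.
have h_x0 : h x0 = 0 by have := h_a N (ltnSn N); rewrite /a ltnn.
have h_a0 i : (i < N)%N -> h (a0 i) = 0.
  by move=> iN; have := h_a i (ltnW iN); rewrite /a iN.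
have [H [Hc HE]] := lip_extension h_lip.
have muH := small _ h_lip h_x0 h_a0 _ Hc HE.
have gkc : continuous (fun b => g b + k b) by exact: (in_GD gG kG).1.
have uc : continuous (fun b => H b + (g b + k b)).
  by move=> b; apply: cvgD; [exact: Hc|exact: gkc].
have uE x y : x <> y -> H (iota x y) + (g (iota x y) + k (iota x y)) =
    (h x + (D x y + Num.min (d x y) r) - h y) / d x y.
  move=> xy; rewrite HE// kE// /D; field.
  by rewrite gt_eqF// d_gt0.
(* Half of [eps] pays for [H] and half for [g + k]; nonnegativity is [h_step] divided by [d x y]. *)
exists (fun b => H b + (g b + k b)), N.+1, a; split => //.
- move=> b; apply: (@stone_cech_ge _ setT 0 uc openT _ b I).
  by move=> x y xy _; rewrite uE// divr_ge0// subr_ge0.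
- by rewrite mu_pos.1//; lra.
- move=> x y xy far; rewrite uE// ler_pM2r ?invr_gt0 ?d_gt0//.
  (* Far from the centres [w = r] and [F + r >= 0], so [h = F + r], and [F_step] leaves
     [min(d x y, r)]. *)
  have wE z : (forall i, (i < N.+1)%N -> r <= d (a i) z) -> w z = r.
    move=> rd; apply/eqP; rewrite eq_le w_le_r; apply/bigmin_geP.
    by split => // i _; apply: rd.
  have wx : w x = r by apply: wE => i /far[].
  have wy : w y = r by apply: wE => i /far[].
  rewrite /h wx wy !max_l; [|have := F_ge y; lra|have := F_ge x; lra].
  by have := F_step x y; lra.
Qed.

End Majorant.

(** * Countable exhaustion of [Gamma] *)

Theorem theorem5p4 (R : realType) (M : Type) (d : M -> M -> R) (x0 : M)
  (Hmetric : is_metric d) (Hcomplete : metric_complete d)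
  (Hthree : exists a b c : M, [/\ a <> b, b <> c & a <> c])
  (B : topologicalType) (iota : M -> M -> B)
  (HB : is_stone_cech_tilde d iota)
  (K : topologicalType) (j : M -> K) (HK : is_samuel d j)
  (p1 p2 : B -> K) (Hp1 : continuous p1) (Hp2 : continuous p2)
  (Hp1e : forall x y, x <> y -> p1 (iota x y) = j x)
  (Hp2e : forall x y, x <> y -> p2 (iota x y) = j y)
  (dbar : K -> \bar R) (Hdbar : continuous dbar)
  (Hdbare : forall x, dbar (j x) = (d x x0)%:E)
  (mu : (B -> R) -> R) (Hpos : pos_functional mu)
  (Hmin : preceq_minimal d iota mu)
  (Hconc : radon_null mu (~` [set b | lip_realcomp dbar (p1 b) /\
                                     lip_realcomp dbar (p2 b)]))
  (Hfree : exists m, in_free d x0 m /\ phistar_is d iota x0 mu m) :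
  radon_null mu [set b | (lip_realcomp dbar (p1 b) /\ ~ (exists x, p1 b = j x)) /\
                       (lip_realcomp dbar (p2 b) /\ ~ (exists x, p2 b = j x))].
Proof.
have [d0 [d_eq0 [dC dT]]] := Hmetric.
(* Distance from [M] lets [small_majorant] apply, and the bound on the distance to [x0] keeps
   [min(d, r) / d] away from zero. *)
pose P n := [set xi | far_from d j n.+1%:R^-1 xi /\ (dbar xi < n.+1%:R%:E)%E].
have P_exhaust xi : lip_realcomp dbar xi -> ~ (exists x, xi = j x) ->
    exists N, forall n, (N <= n)%N -> P n xi.
  move=> xi_fin /(samuel_far Hmetric Hcomplete HK)[rho rho0 far].
  have [c xic] : exists c : R, (dbar xi < c%:E)%E.
    move: xi_fin; rewrite /lip_realcomp /=; case: (dbar xi) => [c|//|] _.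
      by exists (c + 1); rewrite lte_fin ltrDl.
    by exists 0; exact: ltNyr.
  exists (maxn (Num.bound rho^-1) (Num.bound `|c|)) => n.
  rewrite geq_max => /andP[rn cn].
  have rhoV : rho^-1 < n.+1%:R.
    have /lt_le_trans : rho^-1 < (Num.bound rho^-1)%:R.
      by apply: archi_boundP; rewrite invr_ge0 ltW.
    by apply; rewrite ler_nat leqW.
  have c_lt : c < n.+1%:R.
    apply: le_lt_trans (ler_norm c) _.
    have /lt_le_trans : `|c| < (Num.bound `|c|)%:R by exact: archi_boundP.
    by apply; rewrite ler_nat leqW.
  split; last by apply: lt_trans xic _; rewrite lte_fin.
  move=> s; have [V [oV Vxi VP]] := far s; exists V; split => // x /VP.
  by apply: le_trans; rewrite -[leRHS]invrK lef_pV2 ?posrE ?invr_gt0 ?ltr0n// ltW.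
have sub : [set b | (lip_realcomp dbar (p1 b) /\ ~ (exists x, p1 b = j x)) /\
    (lip_realcomp dbar (p2 b) /\ ~ (exists x, p2 b = j x))] `<=`
    \bigcup_n [set b | P n (p1 b) /\ P n (p2 b)].
  move=> b [[fin1 M1] [fin2 M2]].
  have [N1 h1] := P_exhaust _ fin1 M1; have [N2 h2] := P_exhaust _ fin2 M2.
  exists (maxn N1 N2) => //=.
  by split; [apply: h1; exact: leq_maxl|apply: h2; exact: leq_maxr].
suff nullP : radon_null mu (\bigcup_n [set b | P n (p1 b) /\ P n (p2 b)]).
  move=> eps eps0; have [U [oU PU Ule]] := nullP eps eps0.
  by exists U; split => //; exact: subset_trans PU.
apply: radon_null_bigcup => //; first exact: HB.1.
move=> n eps eps0; set r : R := n.+1%:R^-1.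
have n0 : (0 : R) < n.+1%:R by rewrite ltr0n.
have r0 : 0 < r by rewrite invr_gt0.
have r1 : r <= 1 by rewrite invf_le1// ler1n.
(* Lower bound of [min(d, r) / d] on pairs within [n + 1] of [x0], where [d <= 2 * (n + 1)]. *)
pose c := r / (2 * n.+1%:R).
have c0 : 0 < c by rewrite divr_gt0// mulr_gt0.
(* This budget anticipates the factor [2 / c], which lifts [u >= c] above [1]. *)
have e0 : 0 < eps * c / 2 by rewrite divr_gt0// mulr_gt0.
have [u [N [a [uc u_ge0 mu_u uP]]]] :=
  small_majorant Hmetric HB Hpos Hmin Hthree Hfree r0 e0.
exists (fun b => 2 / c * u b); split.
- by move=> b; apply: cvgM; [exact: cvg_cst|exact: uc].
- by move=> b; rewrite mulr_ge0// divr_ge0// ltW.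
- rewrite Hpos.2.1// mulrAC ler_pdivrMr//; lra.
move=> b [[far1 fin1] [far2 fin2]].
suff : c <= u b by rewrite mulrAC ltr_pdivlMr//; lra.
have [V1 [oV1 Vb1 VP1]] := far_from_finite a N far1.
have [V2 [oV2 Vb2 VP2]] := far_from_finite a N far2.
pose W := [set z | (dbar z < n.+1%:R%:E)%E].
have oW : open W.
  by apply: (open_comp _ (@open_ereal_lt_ereal R n.+1%:R%:E)) => z _; exact: Hdbar.
(* The bound is checked at pairs of points of [M] near [b] and reaches [b] by density. *)
apply: (stone_cech_ge HB uc (V := p1 @^-1` (V1 `&` W) `&` p2 @^-1` (V2 `&` W))).
- apply: openI; apply: open_comp => [z _|]; try exact: openI.
    exact: Hp1.
  exact: Hp2.
- move=> x y xy [/= [V1x Wx] [V2y Wy]].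
  rewrite !(Hp1e _ _ xy) in V1x Wx; rewrite !(Hp2e _ _ xy) in V2y Wy.
  apply: le_trans (uP _ _ xy _); last first.
    by move=> i iN; split; [exact: VP1|exact: VP2].
  move: Wx Wy; rewrite /W /= !Hdbare !lte_fin => Wx Wy.
  have dxy : 0 < d x y.
    by rewrite lt_neqAle d0 andbT; apply/eqP => /esym/d_eq0.
  have dn : d x y <= 2 * n.+1%:R by have := dT x x0 y; rewrite (dC x0 y); lra.
  rewrite /c ler_pdivrMr ?mulr_gt0// mulrAC ler_pdivlMr//.
  have n1 : 1 <= n.+1%:R :> R by rewrite ler1n.
  case: (leP (d x y) r) => _; nra.
- by [].
Qed.
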